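(* Let $k,\ell>2$ be integers. If $\ell$ is even, then $$\gamma_{gr}^{t}(P_k\circ C_\ell)=\begin{cases}\frac{k}{2}\cdot(\ell-2)+1, & k\text{ even},\\ \left\lceil\frac{k}{2}\right\rceil\cdot(\ell-2), & k\text{ odd}.\end{cases}$$ If $\ell$ is odd, then $$\gamma_{gr}^{t}(P_k\circ C_\ell)=\begin{cases}\frac{k}{2}\cdot(\ell-1)+1, & k\text{ even},\\ \left\lceil\frac{k}{2}\right\rceil\cdot(\ell-1), & k\text{ odd}.\end{cases}$$
   Context: $P_n$ and $C_n$ denote the path and the cycle on $n$ vertices. $N(v)$ denotes the open neighborhood of $v$. A sequence $(v_1,\ldots,v_m)$ of distinct vertices of a graph $G$ is a (legal) open neighborhood sequence if $N(v_i)\setminus\bigcup_{j=1}^{i-1}N(v_j)\neq\emptyset$ for each $i$. The Grundy total domination number $\gamma_{gr}^{t}(G)$ is the maximum length of a legal open neighborhood sequence of $G$. The lexicographic product $G\circ H$ has vertex set $V(G)\times V(H)$, and $(g_1,h_1)$, $(g_2,h_2)$ are adjacent iff $g_1g_2\in E(G)$, or $g_1=g_2$ and $h_1h_2\in E(H)$. *)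

(* Defs.v *)
From mathcomp Require Import all_boot.

Set Implicit Arguments.
Unset Strict Implicit.
Unset Printing Implicit Defensive.

(* A finite simple graph is a finType of vertices with a symmetric and
   irreflexive adjacency relation. *)

Definition path_rel (n : nat) : rel 'I_n :=
  fun i j => (i.+1 == j) || (j.+1 == i).

(* [ordS] is the successor modulo n; this is the cycle C_n for n > 2. *)
Definition cycle_rel (n : nat) : rel 'I_n :=
  fun i j => (ordS i == j) || (ordS j == i).

Definition lexprod (S T : finType) (e : rel S) (f : rel T) : rel (S * T) :=
  fun x y => e x.1 y.1 || (x.1 == y.1) && f x.2 y.2.

Definition open_nbhd (T : finType) (e : rel T) (v : T) : {set T} :=
  [set w | e v w].

Definition open_nbhd_seq (T : finType) (e : rel T) (m : nat)
    (s : m.-tuple T) : bool :=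
  uniq s &&
  [forall i : 'I_m,
     open_nbhd e (tnth s i)
       :\: \bigcup_(j < m | j < i) open_nbhd e (tnth s j) != set0].

(* The empty sequence is legal and legal sequences have length at most #|T|,
   so this maximum ranges over all lengths of legal sequences; see
   [leq_grundy_total] and [grundy_total_attained]. *)
Definition grundy_total (T : finType) (e : rel T) : nat :=
  \max_(m < #|T|.+1 | [exists s : m.-tuple T, open_nbhd_seq e s]) m.

Lemma leq_grundy_total (T : finType) (e : rel T) (m : nat) (s : m.-tuple T) :
  open_nbhd_seq e s -> m <= grundy_total e.
Proof.
move=> Hs; have /andP[Us _] := Hs.
have Hm : m < #|T|.+1.
  by rewrite ltnS -{1}(size_tuple s) -(card_uniqP Us) max_card.
by apply: (bigmax_sup (Ordinal Hm)) => //; apply/existsP; exists s.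
Qed.

Lemma grundy_total_attained (T : finType) (e : rel T) :
  exists s : (grundy_total e).-tuple T, open_nbhd_seq e s.
Proof.
have H0 : [exists s : (@ord0 #|T|).-tuple T, open_nbhd_seq e s].
  apply/existsP; exists [tuple]; apply/andP; split=> //.
  by apply/forallP; case.
rewrite /grundy_total (bigmax_eq_arg ord0) //.
by case: arg_maxnP => // m /existsP[s Hs] _; exists s.
Qed.

Lemma path_rel_sym n : symmetric (@path_rel n).
Proof. by move=> i j; rewrite /path_rel orbC. Qed.

Lemma path_rel_irr n : irreflexive (@path_rel n).
Proof. by move=> i; rewrite /path_rel orbb gtn_eqF. Qed.

Lemma cycle_rel_sym n : symmetric (@cycle_rel n).
Proof. by move=> i j; rewrite /cycle_rel orbC. Qed.

Lemma cycle_rel_irr n : 1 < n -> irreflexive (@cycle_rel n).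
Proof.
move=> n1 i; rewrite /cycle_rel orbb; apply/negbTE/eqP => /(congr1 val) /=.
have := ltn_ord i; rewrite leq_eqVlt => /orP[/eqP E|lt_i].
  by rewrite E modnn => i0; move: n1; rewrite -E -i0.
by rewrite modn_small // => /eqP; rewrite gtn_eqF.
Qed.

Lemma lexprod_sym (S T : finType) (e : rel S) (f : rel T) :
  symmetric e -> symmetric f -> symmetric (lexprod e f).
Proof. by move=> He Hf x y; rewrite /lexprod He Hf eq_sym. Qed.

Lemma lexprod_irr (S T : finType) (e : rel S) (f : rel T) :
  irreflexive e -> irreflexive f -> irreflexive (lexprod e f).
Proof. by move=> He Hf x; rewrite /lexprod He Hf andbF. Qed.

(* Main.v *)
(* Fix a longest legal sequence of G o H, a footprint for each of its vertices
   (in the vertex's own layer whenever possible), and let t(g) be the time at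
   which the layer of g is first used.  Let A be the set of layers used
   strictly before all neighbouring layers.  A vertex in layer g covers the
   neighbouring layers entirely; hence the footprints lying in a layer of A
   come from a legal sequence of H, so there are at most c = gamma(H) of them,
   while a footprint outside A comes from the first vertex of a layer g not in
   A with a neighbour g' such that t(g) < t(g').  So the length is at most
   c |A| + |U \ A|, U being the set of used layers with a later neighbour.
   When G is a path, between two elements of A the layer maximizing t is not in
   U, hence |A| <= |~U| + 1, and the upper bound is arithmetic from c >= 2.
   It is attained on A = {0, 2, ..., k-1} for k odd, and for k even on
   A = {0, 3, 5, ..., k-1} with one vertex of layer 1 inserted after layer 0:
   it footprints layer 2.
   For the cycle, if every vertex with a neighbour in X has two there, then some
   vertex of X is no footprint: the first vertex to footprint something in X
   covers a second vertex of X.  Take X to be everything, resp. the two parity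
   classes when l is even. *)

Require Import Defs.
From mathcomp Require Import all_boot zify.

Set Implicit Arguments.
Unset Strict Implicit.
Unset Printing Implicit Defensive.

(** * Legal sequences as ranked families with footprints *)

(* Vertices [y p], [p \in P], played by increasing rank [r p], with footprints
   [w p]. *)
Lemma footprints_leq_grundy (T I : finType) (e : rel T) (P : {set I})
    (r : I -> nat) (y w : I -> T) :
  {in P &, injective r} ->
  (forall p, p \in P -> e (y p) (w p)) ->
  (forall p q, p \in P -> q \in P -> r p < r q -> ~~ e (y p) (w q)) ->
  #|P| <= grundy_total e.
Proof.
move=> r_inj yw ynw.
pose s := sort (relpre r leq) (enum P).
have ss : size s == #|P| by rewrite size_sort cardE.
have sP p : (p \in s) = (p \in P) by rewrite mem_sort mem_enum.
have us : uniq s by rewrite sort_uniq enum_uniq.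
have sorted_s : pairwise (relpre r leq) s.
  rewrite -sorted_pairwise; last by move=> a b c /=; apply: leq_trans.
  by apply: sort_sorted => a b /=; apply: leq_total.
pose t : #|P|.-tuple I := Tuple ss.
have tP i : tnth t i \in P by rewrite -sP; apply: mem_tnth.
have tlt (i j : 'I_#|P|) : j < i -> r (tnth t j) < r (tnth t i).
  move=> ji; have x0 := tnth t i.
  have si (k : 'I_#|P|) : k < size s by rewrite (eqP ss).
  rewrite ltn_neqAle; apply/andP; split.
    apply/eqP => /(r_inj _ _ (tP _) (tP _)) /eqP.
    by rewrite !(tnth_nth x0) nth_uniq ?si // ltn_eqF.
  by rewrite !(tnth_nth x0); apply: (pairwiseP x0 sorted_s) => //; exact: si.
apply: (@leq_grundy_total _ _ _ (map_tuple y t)).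
apply/andP; split.
  (* If a vertex were repeated, its earlier occurrence would cover the footprint of the later
     one. *)
  rewrite map_inj_in_uniq // => p q; rewrite !sP => pP qP ypq.
  case: (ltngtP (r p) (r q)) => [lt|lt|/r_inj]; last exact.
    by have := ynw _ _ pP qP lt; rewrite ypq yw.
  by have := ynw _ _ qP pP lt; rewrite -ypq yw.
apply/forallP => i; apply/set0Pn; exists (w (tnth t i)).
rewrite in_setD !inE tnth_map yw ?tP // andbT.
apply/bigcupP => -[j ji]; rewrite inE tnth_map; apply/negP.
exact: ynw (tlt _ _ ji).
Qed.

Lemma grundy_footprints (T : finType) (e : rel T) :
  exists y w : 'I_(grundy_total e) -> T,
    (forall p, e (y p) (w p)) /\
    (forall p q : 'I_(grundy_total e), p < q -> ~~ e (y p) (w q)).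
Proof.
have [s /andP[_ /forallP fs]] := grundy_total_attained e.
have {fs} [w wP] := fin_all_exists (fun i => set0Pn _ (fs i)).
exists (tnth s), w; split=> [p|p q pq].
  by have := wP p; rewrite in_setD inE => /andP[].
have := wP q; rewrite in_setD => /andP[+ _]; apply: contra => epq.
by apply/bigcupP; exists p; rewrite ?inE.
Qed.

(** [t] is the index in the list of values of [g]; a value never taken gets index [n]. *)
Lemma first_occurrence (S : eqType) (n : nat) (g : 'I_n -> S) :
  exists t : S -> nat, (forall p, t (g p) <= p) /\
    (forall i, t i < n -> exists2 p : 'I_n, t i = p & g p = i).
Proof.
pose s := [seq g p | p <- enum 'I_n].
have ss : size s = n by rewrite size_map size_enum_ord.
exists (index^~ s); split=> [p|i lt_in].
  have -> : g p = nth (g p) s p.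
    by rewrite (nth_map p) ?size_enum_ord // nth_ord_enum.
  rewrite leqNgt; apply/negP => /(before_find (g p)) /=.
  by rewrite eqxx.
exists (Ordinal lt_in) => //.
have := lt_in; rewrite -[X in _ < X]ss index_mem => si.
rewrite -[RHS](nth_index (g (Ordinal lt_in)) si) (nth_map (Ordinal lt_in)).
  by congr g; apply: val_inj; rewrite /= nth_enum_ord.
by rewrite size_enum_ord.
Qed.

(** * Upper bound for lexicographic products *)

(* [t i < n] means that the layer [i] is used. *)
Definition local_minima (S : finType) (e : rel S) (n : nat) (t : S -> nat) : {set S} :=
  [set i | (t i < n) && [forall j, e i j ==> (t i < t j)]].

Definition with_later_nbr (S : finType) (e : rel S) (n : nat) (t : S -> nat) : {set S} :=
  [set i | (t i < n) && [exists j, e i j && (t i < t j)]].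

Lemma grundy_lexprod_upper (S T : finType) (e : rel S) (f : rel T)
    (es : symmetric e) (ei : irreflexive e) (fs : symmetric f)
    (fn : forall h, exists h', f h h') :
  exists (n : nat) (t : S -> nat),
    grundy_total (lexprod e f) <= #|local_minima e n t| * grundy_total f
      + #|with_later_nbr e n t :\: local_minima e n t|.
Proof.
have [y [w0 [yw0 ynw0]]] := grundy_footprints (lexprod e f).
set n := grundy_total _ in y w0 yw0 ynw0 *.
have [t [t_le t_ex]] := first_occurrence (fun p => (y p).1).
(* A footprint in the layer of [y p] is preferred; the third clause records that otherwise all
   neighbours of [y p] in that layer are already covered. *)
have : forall p, exists v, [/\ lexprod e f (y p) v,
    forall q : 'I_n, q < p -> ~~ lexprod e f (y q) v &
    v.1 <> (y p).1 -> forall h, f (y p).2 h ->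
      exists2 q : 'I_n, q < p & lexprod e f (y q) ((y p).1, h)].
  move=> p.
  case: (boolP [exists h, f (y p).2 h &&
      [forall (q : 'I_n | q < p), ~~ lexprod e f (y q) ((y p).1, h)]]).
    case/existsP => h /andP[fh /forall_inP qh].
    by exists ((y p).1, h); split => //; rewrite /lexprod /= eqxx fh orbT.
  move=> /existsPn nex; exists (w0 p); split => //.
    by move=> q; apply: ynw0.
  move=> _ h fh; have := nex h; rewrite fh /=.
  by case/forall_inPn => q qp; rewrite negbK => H; exists q.
case/fin_all_exists => w wP.
have yw p : lexprod e f (y p) (w p) by case: (wP p).
have ynw (p q : 'I_n) : p < q -> ~~ lexprod e f (y p) (w q).
  by case: (wP q) => _ H _; apply: H.
(* A layer receiving a footprint at time [p] has no neighbour used before. *)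
have late p i : e i (w p).1 -> p <= t i.
  move=> ei'; rewrite leqNgt; apply/negP => tp.
  have [q tq yq] := t_ex i (ltn_trans tp (ltn_ord p)).
  by have := ynw q p; rewrite -tq tp /lexprod yq ei' => /(_ isT).
exists n, t; set A := local_minima e n t; set U := with_later_nbr e n t.
(* By [late], neighbouring layers start no earlier than [p]; none starts at [p], since [y p] would
   then lie in a layer adjacent to itself. *)
have own p : (w p).1 = (y p).1 -> (y p).1 \in A.
  move=> wy; rewrite inE (leq_ltn_trans (t_le p)) //=.
  apply/forallP => j; apply/implyP => ej; apply: leq_ltn_trans (t_le p) _.
  have := late p j; rewrite wy es => /(_ ej); rewrite leq_eqVlt => /orP[/eqP pj|//].
  have [q tq yq] : exists2 q : 'I_n, t j = q & (y q).1 = j.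
    by apply: t_ex; rewrite -pj.
  move: ej; rewrite -yq (_ : q = p) ?ei //.
  by apply: val_inj; rewrite /= -tq.
(* For the last claim, some earlier [y q] covers a neighbour of [y p] in its own layer: from an
   adjacent layer this denies minimality, from the same layer it denies first use. *)
have off p : (w p).1 <> (y p).1 ->
    [/\ e (y p).1 (w p).1, t (y p).1 = p & (y p).1 \notin A].
  move=> wy; have eyw : e (y p).1 (w p).1.
    by move: (yw p); rewrite /lexprod => /orP[//|/andP[/eqP yw1 _]]; case: wy.
  have tp : t (y p).1 = p by apply/eqP; rewrite eqn_leq t_le late.
  split=> //; apply/negP; rewrite inE => /andP[_ /forallP yA].
  have [h fh] := fn (y p).2; have [_ _ /(_ wy h fh)[q qp]] := wP p.
  rewrite /lexprod /= => /orP[eq|/andP[/eqP qi _]].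
    have := yA (y q).1; rewrite es eq tp ltnNge => /negP; apply.
    exact: leq_trans (t_le q) (ltnW qp).
  by have := t_le q; rewrite qi tp leqNgt qp.
pose PA := [set p | (w p).1 \in A].
have -> : n = #|PA| + #|~: PA| by rewrite cardsC card_ord.
apply: leq_add; last first.
  have offC p : p \in ~: PA -> (w p).1 <> (y p).1.
    by rewrite in_setC in_set => /negP pA wy; apply: pA; rewrite wy; apply: own.
  (* Such a [p] is determined by the layer of [y p], being its first time of use. *)
  rewrite -(card_in_imset (f := fun p => (y p).1)); last first.
    move=> p q /offC/off[_ tp _] /offC/off[_ tq _] ypq.
    by apply: val_inj; rewrite /= -tp -tq ypq.
  apply/subset_leq_card/subsetP => _ /imsetP[p pC ->].
  have [eyw tp yA] := off p (offC p pC).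
  rewrite in_setD yA inE tp ltn_ord /=.
  (* If the layer of [w p] were first used at some [q < p], then, not being a local minimum, it
     would have a neighbour used by time [q], against [late]. *)
  apply/existsP; exists (w p).1; rewrite eyw /= ltnNge; apply/negP => wp.
  have wn : t (w p).1 < n := leq_ltn_trans wp (ltn_ord p).
  have [q tq yq] := t_ex _ wn.
  have qp : q < p.
    rewrite ltn_neqAle -{2}tq wp andbT; apply/eqP => /val_inj qp.
    by apply: (offC p pC); rewrite -yq qp.
  move: pC; rewrite !inE wn /= => /forallPn[j].
  rewrite negb_imply -leqNgt es tq => /andP[/late jp jq].
  by move: (leq_trans jp jq); rewrite leqNgt qp.
have [nb nbP] := fin_all_exists fn.
rewrite -sum1_card (partition_big (fun p => (w p).1) (mem A)) /=; last first.
  by move=> p; rewrite inE.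
rewrite -sum_nat_const; apply: leq_sum => j jA.
pose Pj := [set p | (w p).1 == j].
apply: (@leq_trans #|Pj|).
  rewrite sum1_card; apply/subset_leq_card/subsetP => p.
  by case/andP => _ wpj; rewrite inE.
(* The only vertex outside layer [j] with its footprint in [j] is the last one;
   replace it by a neighbour in [H] of its footprint. *)
apply: (@footprints_leq_grundy _ _ _ _ val
  (fun p => if (y p).1 == j then (y p).2 else nb (w p).2) (fun p => (w p).2)).
- by move=> p q _ _; apply: val_inj.
- move=> p; rewrite inE => /eqP wj; case: eqP => [yj|_]; last by rewrite fs.
  by have := yw p; rewrite /lexprod wj yj ei eqxx.
move=> p q; rewrite !inE => /eqP pj /eqP qj pq; case: eqP => [yj|yj].
  by have := ynw p q pq; rewrite /lexprod qj yj ei eqxx.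
have [|eyw tp _] := off p; first by rewrite pj => jy; apply: yj.
by have := late q (y p).1; rewrite qj -pj tp leqNgt pq => /(_ eyw).
Qed.

(** * Local minima along a path *)

Lemma between_card (k : nat) (A O : {set 'I_k}) :
  (forall i j, i \in A -> j \in A -> i < j ->
     exists2 m, m \in O & (i < m < j)) ->
  #|A| <= #|O|.+1.
Proof.
(* The number of elements of [O] below [i] is strictly increasing on [A] and at most [#|O|]. *)
move=> btw; pose h (i : 'I_k) := #|[set m in O | m < i]|.
have hlt i : h i < #|O|.+1.
  by rewrite ltnS; apply/subset_leq_card/subsetP => m; rewrite inE => /andP[].
have hmono i j : i \in A -> j \in A -> i < j -> h i < h j.
  move=> iA jA ij; have [m mO /andP[im mj]] := btw i j iA jA ij.
  apply/proper_card/properP; split.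
    by apply/subsetP => x; rewrite !inE => /andP[-> /ltn_trans]; apply.
  by exists m; rewrite !inE mO //= -leqNgt ltnW.
pose g i := Ordinal (hlt i).
have g_inj : {in A &, injective g}.
  move=> i j iA jA /(congr1 val) /= hij; case: (ltngtP i j) => [ij|ij|/val_inj //].
    by have := hmono _ _ iA jA ij; rewrite hij ltnn.
  by have := hmono _ _ jA iA ij; rewrite hij ltnn.
by rewrite -(card_in_imset g_inj) -[X in _ <= X]card_ord max_card.
Qed.

Lemma path_between (k n : nat) (t : 'I_k -> nat) :
  #|local_minima (@path_rel k) n t| <= #|~: with_later_nbr (@path_rel k) n t|.+1.
Proof.
set A := local_minima _ n t; apply: between_card => i j iA jA ij.
have Amin a b : a \in A -> path_rel a b -> t a < t b.
  by rewrite inE => /andP[_ /forallP/(_ b)/implyP].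
have ijP : i <= i <= j by rewrite leqnn ltnW.
case: (@arg_maxnP _ i (fun m : 'I_k => i <= m <= j) t ijP) => m /andP[im mj] mmax.
(* The inner neighbours of [i] and [j] are used later than [i] and [j], so [m] is interior and both
   its neighbours stay in the interval. *)
have i1 : i.+1 < k by apply: leq_ltn_trans ij (ltn_ord j).
have j1 : j.-1 < k by apply: leq_ltn_trans (leq_pred j) (ltn_ord j).
have ti : t i < t m.
  apply: leq_trans (Amin _ (Ordinal i1) iA _) (mmax _ _) => /=.
    by rewrite /path_rel eqxx.
  by rewrite leqnSn.
have tj : t j < t m.
  apply: leq_trans (Amin _ (Ordinal j1) jA _) (mmax _ _) => /=.
    by rewrite /path_rel /= prednK ?eqxx ?orbT //; lia.
  by lia.
have im' : i < m.
  by rewrite ltn_neqAle im andbT; apply: contraTneq ti => /val_inj ->; rewrite ltnn.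
have mj' : m < j.
  by rewrite ltn_neqAle mj andbT; apply: contraTneq tj => /val_inj ->; rewrite ltnn.
exists m; last by rewrite im' mj'.
rewrite in_setC inE negb_and; apply/orP; right; apply/existsPn => x.
rewrite negb_and -leqNgt orbC; case: (leqP (t x) (t m)) => //= tmx.
apply: contraTN tmx; rewrite -leqNgt /path_rel => mx; apply: mmax; lia.
Qed.

(** * Open neighborhood sequences of cycles *)

Lemma grundy_unfootprinted (T : finType) (e : rel T) (m : nat)
    (y w : 'I_m -> T) (X : {set T}) (x0 : T) :
  (forall p, e (y p) (w p)) ->
  (forall p q : 'I_m, p < q -> ~~ e (y p) (w q)) ->
  x0 \in X ->
  (forall v u, e v u -> u \in X -> exists2 u', u' \in X & u' != u /\ e v u') ->
  exists2 u, u \in X & forall p, w p != u.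
Proof.
move=> yw ynw x0X two.
case: (pickP (fun p => w p \in X)) => [p0 p0X|noX]; last first.
  by exists x0 => // p; apply: contraFneq (noX p) => ->.
case: (@arg_minnP _ p0 (fun p => w p \in X) val p0X) => p pX pmin.
(* [u] is no footprint before [p] by minimality, nor at [p], nor later since [y p] covers it. *)
have [u uX [upw eyu]] := two _ _ (yw p) pX.
exists u => // q; apply/eqP => wq.
have pq : p <= q by apply: pmin; rewrite wq.
move: pq; rewrite leq_eqVlt => /orP[/eqP/val_inj pq|/ynw].
  by rewrite pq wq eqxx in upw.
by rewrite wq eyu.
Qed.

(** Spells out the wrap-around edge instead of the modulus, so that [lia] decides adjacency. *)
Lemma cycle_relE (l : nat) (i j : 'I_l) :
  cycle_rel i j = [|| i.+1 == j, j.+1 == i, (i == l.-1 :> nat) && (j == 0 :> nat)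
                    | (j == l.-1 :> nat) && (i == 0 :> nat)].
Proof.
have E (a b : 'I_l) : (ordS a == b) =
    (a.+1 == b) || (a == l.-1 :> nat) && (b == 0 :> nat).
  rewrite -val_eqE /=; have := ltn_ord a; have := ltn_ord b.
  rewrite leq_eqVlt => lb; rewrite leq_eqVlt => /orP[/eqP al|al].
    by rewrite al modnn; lia.
  by rewrite modn_small //; lia.
by rewrite /cycle_rel !E; lia.
Qed.

Lemma cycle_grundy_lower (l : nat) :
  2 < l -> l - 2 <= grundy_total (@cycle_rel l).
Proof.
move=> hl.
have Hy (p : 'I_(l - 2)) : p < l by have := ltn_ord p; lia.
have Hw (p : 'I_(l - 2)) : p.+1 < l by have := ltn_ord p; lia.
rewrite -[X in X <= _](card_ord (l - 2)) -cardsT.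
(* Vertices 0, ..., l-3 footprint their successors; l-1, the other neighbour of 0, is never a
   footprint. *)
apply: (@footprints_leq_grundy _ _ _ _ val (fun p => Ordinal (Hy p))
  (fun p => Ordinal (Hw p))).
- by move=> p q _ _ /val_inj.
- by move=> p _; rewrite cycle_relE /= eqxx.
move=> p q _ _ /= pq; rewrite cycle_relE /=.
by have := ltn_ord p; have := ltn_ord q; lia.
Qed.

Lemma cycle_grundy_lower_odd (l : nat) :
  2 < l -> odd l -> l - 1 <= grundy_total (@cycle_rel l).
Proof.
move=> hl ol.
(* Steps of two around the cycle: 2p footprints 2p+1 modulo l. Its other neighbour 2p-1 is the
   previous footprint, or l-1 for p = 0, reached only at the excluded time l-1. *)
pose md m := if m < l then m else m - l.
have Hy (p : 'I_(l - 1)) : md p.*2 < l by have := ltn_ord p; rewrite /md; case: ifP; lia.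
have Hw (p : 'I_(l - 1)) : md p.*2.+1 < l by have := ltn_ord p; rewrite /md; case: ifP; lia.
rewrite -[X in X <= _](card_ord (l - 1)) -cardsT.
apply: (@footprints_leq_grundy _ _ _ _ val (fun p => Ordinal (Hy p))
  (fun p => Ordinal (Hw p))).
- by move=> p q _ _ /val_inj.
- by move=> p _; rewrite cycle_relE /= /md; have := ltn_ord p; case: ifP; case: ifP; lia.
move=> p q _ _ /= pq; rewrite cycle_relE /=.
by have := ltn_ord p; have := ltn_ord q; rewrite /md; case: ifP; case: ifP; lia.
Qed.

Lemma footprint_inj (T : finType) (e : rel T) (m : nat) (y w : 'I_m -> T) :
  (forall p, e (y p) (w p)) ->
  (forall p q : 'I_m, p < q -> ~~ e (y p) (w q)) -> injective w.
Proof.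
move=> yw ynw p q wpq; case: (ltngtP p q) => [/ynw|/ynw|/val_inj //].
  by rewrite -wpq yw.
by rewrite wpq yw.
Qed.

Lemma cycle_other_nbr (l : nat) (v u : 'I_l) :
  2 < l -> cycle_rel v u -> exists2 u', u' != u & cycle_rel v u'.
Proof.
move=> hl; have lv := ltn_ord v.
have [s sE] : exists s : 'I_l, s = (if v == l.-1 :> nat then 0 else v.+1) :> nat.
  have Hs : (if v == l.-1 :> nat then 0 else v.+1) < l by case: ifP; lia.
  by exists (Ordinal Hs).
have [p pE] : exists p : 'I_l, p = (if v == 0 :> nat then l.-1 else v.-1) :> nat.
  have Hp : (if v == 0 :> nat then l.-1 else v.-1) < l by case: ifP; lia.
  by exists (Ordinal Hp).
case: (eqVneq s u) => [<- _|su _]; last first.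
  by exists s; rewrite ?cycle_relE //; move: sE; case: ifP; lia.
by exists p; rewrite ?cycle_relE -?val_eqE /=; move: sE pE; do 2?case: ifP; lia.
Qed.

Lemma cycle_grundy_upper (l : nat) :
  2 < l -> grundy_total (@cycle_rel l) <= l - 1.
Proof.
move=> hl; have [y [w [yw ynw]]] := grundy_footprints (@cycle_rel l).
have [||u _ uw] := @grundy_unfootprinted _ _ _ _ _ setT (Ordinal (ltnW (ltnW hl))) yw ynw.
- by rewrite inE.
- by move=> v u /(cycle_other_nbr hl)[u' ? ?]; exists u'; rewrite ?inE.
rewrite -[X in X <= _]card_ord -(card_imset _ (footprint_inj yw ynw)).
have -> : l - 1 = #|~: [set u]| by rewrite cardsC1 card_ord subn1.
by apply/subset_leq_card/subsetP => _ /imsetP[p _ ->]; rewrite !inE.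
Qed.

Lemma cycle_grundy_upper_even (l : nat) :
  2 < l -> ~~ odd l -> grundy_total (@cycle_rel l) <= l - 2.
Proof.
move=> hl el; have [y [w [yw ynw]]] := grundy_footprints (@cycle_rel l).
(* For [l] even the wrap-around edge changes parity too. *)
have parity (i j : 'I_l) : cycle_rel i j -> odd i = ~~ odd j.
  by rewrite cycle_relE; have := ltn_ord i; have := ltn_ord j; lia.
have missed b (x : 'I_l) : odd x = b -> exists2 u : 'I_l, odd u = b & forall p, w p != u.
  move=> xb.
  have [||u uX uw] := @grundy_unfootprinted _ _ _ _ _ [set i : 'I_l | odd i == b] x yw ynw.
  - by rewrite inE xb.
  - move=> v u vu; rewrite inE => /eqP ub; have [u' ? vu'] := cycle_other_nbr hl vu.
    exists u' => //; rewrite inE -ub; apply/eqP/negb_inj.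
    by rewrite -(parity _ _ vu) -(parity _ _ vu').
  by exists u => //; move: uX; rewrite inE => /eqP.
have [u0 o0 w0] := missed false (Ordinal (ltnW (ltnW hl))) erefl.
have [u1 o1 w1] := missed true (Ordinal (ltnW hl)) erefl.
have u01 : u0 != u1 by apply: contraFneq o0 => ->; rewrite o1.
rewrite -[X in X <= _]card_ord -(card_imset _ (footprint_inj yw ynw)).
have -> : l - 2 = #|~: [set u0; u1]|.
  by have := cardsC [set u0; u1]; rewrite cards2 u01 card_ord; lia.
apply/subset_leq_card/subsetP => _ /imsetP[p _ ->].
by rewrite !inE negb_or w0 w1.
Qed.

(** * Upper bound over a path *)

Lemma path_lexprod_upper (k : nat) (T : finType) (f : rel T) :
  1 < k -> symmetric f -> (forall h, exists h', f h h') ->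
  1 < grundy_total f ->
  grundy_total (lexprod (@path_rel k) f) <=
    if odd k then uphalf k * grundy_total f else k./2 * grundy_total f + 1.
Proof.
move=> k1 fs fn c2.
have [n [t]] := grundy_lexprod_upper (@path_rel_sym k) (@path_rel_irr k) fs fn.
have := path_between n t.
set A := local_minima _ n t; set U := with_later_nbr _ n t => AO /leq_trans; apply.
have AU : A \subset U.
  apply/subsetP => i; rewrite !inE => /andP[-> /forallP iA] /=.
  have [j ij] : exists j : 'I_k, path_rel i j.
    case: (ltnP i.+1 k) => [ik|ki].
      by exists (Ordinal ik); rewrite /path_rel eqxx.
    have ik : i.-1 < k by apply: leq_ltn_trans (leq_pred i) (ltn_ord i).
    by exists (Ordinal ik); rewrite /path_rel /= prednK ?eqxx ?orbT //; lia.
  by apply/existsP; exists j; rewrite ij (implyP (iA j)).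
have cA := cardsD U A; rewrite (setIidPr AU) in cA.
have cU := cardsC U; rewrite card_ord in cU.
have cAU := subset_leq_card AU.
move: (grundy_total f) c2 => c c2.
set b := #|U :\: A| in cA *; set a := #|A| in AO cA cAU *; set o := #|~: U| in AO cU.
have kE : k = a + b + o by lia.
(* Since ac + b = a(c-2) + (2a+b) with c >= 2, it suffices to bound 2a + b = k + a - o, where a <= o
   + 1. *)
have [K kK] : exists K, k = odd k + K.*2 by exists k./2; rewrite odd_double_half.
case: ifP => ok.
  have -> : uphalf k = K.+1 by lia.
  have : a.*2 + b <= K.+1.*2 by lia.
  by nia.
have -> : k./2 = K by lia.
(* The additional 1 arises only for a = o + 1; then 2a + b = 2K + 1 still forces a <= K. *)
have [ao|oa] := leqP a o.
  have : a.*2 + b <= K.*2 by lia.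
  by nia.
have ab : a.*2 + b = K.*2.+1 by lia.
by nia.
Qed.

(** * Lower bounds from independent layers *)

Lemma lex_ltn (m i x j x' : nat) : i < j -> x < m -> i * m + x < j * m + x'.
Proof. by nia. Qed.

(** An optimal sequence of the second factor is played in each layer [g i] in turn; independent
    layers do not cover each other. *)
Lemma grundy_lexprod_lower (S T : finType) (e : rel S) (f : rel T) (a : nat)
    (g : 'I_a -> S) :
  injective g -> (forall i j, ~~ e (g i) (g j)) ->
  a * grundy_total f <= grundy_total (lexprod e f).
Proof.
move=> g_inj indep; have [y [w [yw ynw]]] := grundy_footprints f.
set c := grundy_total f in y w yw ynw *.
rewrite -[a in a * _]card_ord -[c in _ * c]card_ord -card_prod -cardsT.
apply: (@footprints_leq_grundy _ _ _ _ (fun p : 'I_a * 'I_c => p.1 * c + p.2)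
  (fun p => (g p.1, y p.2)) (fun p => (g p.1, w p.2))).
- move=> [i x] [j x'] _ _ /= E.
  have := @lex_ltn c i x j x'; have := @lex_ltn c j x' i x; rewrite E ltnn.
  case: (ltngtP i j) => [_ _ /(_ isT (ltn_ord _)) //|_ /(_ isT (ltn_ord _)) //|/val_inj ij _ _].
  by move: E; rewrite ij => /addnI/val_inj ->.
- by move=> [i x] _; rewrite /lexprod /= eqxx yw orbT.
move=> [i x] [j x'] _ _ /= lt; rewrite /lexprod /= (negbTE (indep _ _)) /=.
apply/negP => /andP[/eqP/g_inj ij]; move: lt; rewrite ij ltn_add2l => /ynw.
by move/negP.
Qed.

(* The extra vertex, in layer [u], comes right after those of layer [g ord0]. *)
Lemma grundy_lexprod_lower_extra (S T : finType) (e : rel S) (f : rel T)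
    (a : nat) (g : 'I_a.+1 -> S) (u v : S) (h : T) :
  injective g -> (forall i j, ~~ e (g i) (g j)) -> e u v ->
  g ord0 != v -> ~~ e (g ord0) v ->
  (forall i, i != ord0 -> u != g i /\ ~~ e u (g i)) ->
  a.+1 * grundy_total f + 1 <= grundy_total (lexprod e f).
Proof.
move=> g_inj indep uv g0v ng0v ug; have [y [w [yw ynw]]] := grundy_footprints f.
set c := grundy_total f in y w yw ynw *.
rewrite -{1}[a.+1]card_ord -[c in _ * c]card_ord -card_prod addn1.
rewrite -card_option -cardsT.
(* The stride [c.+1] leaves rank [c], just after layer [g ord0], for the extra vertex. *)
pose r (p : 'I_a.+1 * 'I_c) := p.1 * c.+1 + p.2.
have r_lt (i j : 'I_a.+1) (x x' : 'I_c) : i < j -> r (i, x) < r (j, x').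
  by move=> ij; apply: lex_ltn => //; apply: leqW.
have r_inj : injective r.
  move=> [i x] [j x'] E; case: (ltngtP i j) => [ij|ij|/val_inj ij].
  - by have := r_lt _ _ x x' ij; rewrite E ltnn.
  - by have := r_lt _ _ x' x ij; rewrite E ltnn.
  by move: E; rewrite /r ij => /addnI/val_inj /= ->.
have r_c i x : (r (i, x) < c) = (i == ord0) /\ r (i, x) != c.
  have xc := ltn_ord x; rewrite -val_eqE /r /=.
  by case: (val i) => [|i'] /=; split; nia.
apply: (@footprints_leq_grundy _ _ _ _ (fun p : option ('I_a.+1 * 'I_c) => if p is Some p then r p else c)
  (fun p => if p is Some p then (g p.1, y p.2) else (u, h))
  (fun p => if p is Some p then (g p.1, w p.2) else (v, h))).
- move=> [[i x]|] [[j x']|] _ _ //.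
  + by move/r_inj ->.
  + by move=> E; have [_ /eqP[]] := r_c i x.
  + by move=> E; have [_ /eqP[]] := r_c j x'.
- by move=> [[i x]|] _; rewrite /lexprod /= ?eqxx ?yw ?uv ?orbT.
(* Only layer [g ord0] precedes the extra vertex and must miss layer [v]; only the other layers
   follow it and must be missed by [u]. *)
move=> [[i x]|] [[j x']|] _ _ lt; rewrite /lexprod /= ?ltnn // in lt *.
- rewrite (negbTE (indep _ _)) /=.
  apply/negP => /andP[/eqP/g_inj ij]; move: lt; rewrite ij /r ltn_add2l => /ynw.
  by move/negP.
- by move: lt; rewrite (r_c i x).1 => /eqP ->; rewrite (negbTE ng0v) (negbTE g0v).
have [|/negbTE-> /negbTE->//] := ug j.
by rewrite -(r_c j x').1 -leqNgt ltnW.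
Qed.

(** * Exact values *)

Lemma path_lexprod_grundy (k : nat) (T : finType) (f : rel T) :
  2 < k -> symmetric f -> (forall h, exists h', f h h') ->
  1 < grundy_total f ->
  grundy_total (lexprod (@path_rel k) f) =
    if ~~ odd k then k./2 * grundy_total f + 1 else uphalf k * grundy_total f.
Proof.
move=> k2 fs fn c2; apply/eqP; rewrite eqn_leq if_neg.
rewrite (path_lexprod_upper (ltnW k2)) //=; case: ifP => ok.
  have Hg (i : 'I_(uphalf k)) : i.*2 < k by have := ltn_ord i; lia.
  apply: (@grundy_lexprod_lower _ _ _ _ _ (fun i => Ordinal (Hg i))).
    by move=> i j /(congr1 val) /= /double_inj/val_inj.
  by move=> i j; rewrite /path_rel /=; lia.
have [h _] : exists h : T, true.
  by have [y _] := grundy_footprints f; exists (y (Ordinal (ltnW c2))).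
have [a ka] : exists a, k = a.+2.*2 by exists (k./2 - 2); lia.
subst k; rewrite doubleK.
(* Layers 0, 3, 5, ..., k-1, with [u] = 1 and [v] = 2. *)
pose gn (i : nat) := if i is 0 then 0 else i.*2.+1.
have Hg (i : 'I_a.+2) : gn i < a.+2.*2 by have := ltn_ord i; case: (val i) => /=; lia.
apply: (@grundy_lexprod_lower_extra _ _ _ _ _ (fun i => Ordinal (Hg i))
          (Ordinal (ltnW k2)) (Ordinal k2) h) => //.
- move=> i j /(congr1 val) /= E; apply: val_inj; move: E => /=.
  by case: (val i) (val j) => [|i'] [|j'] /=; lia.
- move=> i j; rewrite /path_rel /=.
  by case: (val i) (val j) => [|i'] [|j'] /=; lia.
move=> i; rewrite -!val_eqE /path_rel /=.
by case: (val i) => [|i'] //=; split; lia.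
Qed.

Theorem corollary3p5 (k l : nat) (hk : 2 < k) (hl : 2 < l) :
  (~~ odd l ->
     grundy_total (lexprod (@path_rel k) (@cycle_rel l)) =
       if ~~ odd k then k./2 * (l - 2) + 1 else uphalf k * (l - 2)) /\
  (odd l ->
     grundy_total (lexprod (@path_rel k) (@cycle_rel l)) =
       if ~~ odd k then k./2 * (l - 1) + 1 else uphalf k * (l - 1)).
Proof.
have fn (h : 'I_l) : exists h', cycle_rel h h'.
  by exists (ordS h); rewrite /cycle_rel eqxx.
split=> ol.
  have cE : grundy_total (@cycle_rel l) = l - 2.
    by apply/eqP; rewrite eqn_leq cycle_grundy_upper_even // cycle_grundy_lower.
  (* The side condition [1 < l - 2] holds because an even [l > 2] is at least 4. *)
  by rewrite (path_lexprod_grundy hk (@cycle_rel_sym l) fn) cE //; lia.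
have cE : grundy_total (@cycle_rel l) = l - 1.
  by apply/eqP; rewrite eqn_leq cycle_grundy_upper // cycle_grundy_lower_odd.
by rewrite (path_lexprod_grundy hk (@cycle_rel_sym l) fn) cE //; lia.
Qed.
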